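(* Let $d,\ell \geq 2$ be integers, let $G$ be an $\{S_d, K_{\ell,\ell}\}$-free graph, and let $I$ be a maximum independent set in $G$. Then $\alpha(G[N[v]]) < d^2 \ell + 2d\ell^{d-1}$ for every $v \in I$. Furthermore, if $d=2$, then $\alpha(G[N[v]]) < 2\ell$ for every $v\in I$.
   Context: Graphs are finite and simple. For $d\ge2$, $S_d$ is the graph obtained from the star $K_{1,d}$ by subdividing each edge exactly once ($S_2=P_5$). $K_{\ell,\ell}$ is the complete bipartite graph with parts of size $\ell$. $\mathcal{F}$-free means having no induced subgraph isomorphic to a member of $\mathcal{F}$. $N[v]$ is the closed neighborhood of $v$ and $\alpha$ the independence number; a maximum independent set is one of size $\alpha(G)$. *)

(* Defs.v *)
From mathcomp Require Import all_boot.

Set Implicit Arguments.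
Unset Strict Implicit.
Unset Printing Implicit Defensive.

Record sgraph := SGraph {
  svertex :> finType;
  sedge : rel svertex;
  sedge_sym : symmetric sedge;
  sedge_irr : irreflexive sedge
}.

Notation "x -- y" := (sedge x y) (at level 30, no associativity).

Definition sg_iso (G H : sgraph) : Prop :=
  exists2 f : G -> H, bijective f & {mono f : x y / x -- y}.

Section Induced.
Variables (G : sgraph) (A : {set G}).

Definition induced_rel : rel {x : G | x \in A} := fun x y => val x -- val y.

Lemma induced_sym : symmetric induced_rel.
Proof. by move=> x y; rewrite /induced_rel sedge_sym. Qed.

Lemma induced_irr : irreflexive induced_rel.
Proof. by move=> x; rewrite /induced_rel sedge_irr. Qed.

Definition induced : sgraph := SGraph induced_sym induced_irr.
End Induced.

Definition free (F : sgraph -> Prop) (G : sgraph) : Prop :=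
  forall H, F H -> ~ exists A : {set G}, sg_iso (induced A) H.

Definition closed_nbh (G : sgraph) (v : G) : {set G} :=
  [set u | (u == v) || v -- u].

Notation "N[ v ]" := (closed_nbh v) (at level 0, format "N[ v ]").

Definition independent (G : sgraph) (S : {set G}) : bool :=
  [forall x in S, forall y in S, ~~ (x -- y)].

Definition alpha (G : sgraph) : nat :=
  \max_(S : {set G} | independent S) #|S|.

Definition maximum_independent (G : sgraph) (I : {set G}) : bool :=
  independent I && (#|I| == alpha G).

Section CompleteBipartite.
Variables m n : nat.

Definition Kbip_rel : rel ('I_m + 'I_n)%type := fun x y =>
  match x, y with
  | inl _, inr _ | inr _, inl _ => true
  | _, _ => false
  end.

Lemma Kbip_sym : symmetric Kbip_rel.
Proof. by case=> x []. Qed.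

Lemma Kbip_irr : irreflexive Kbip_rel.
Proof. by case. Qed.

Definition Kbip : sgraph := SGraph Kbip_sym Kbip_irr.
End CompleteBipartite.

Definition edges (G : sgraph) : {set {set G}} :=
  [set [set p.1; p.2] | p : G * G & p.1 -- p.2].

(* Every edge [e] is replaced by a new vertex [inr e], adjacent exactly to
   the two ends of [e]. *)
Section Subdivision.
Variable G : sgraph.

Definition subdiv_rel : rel (G + {e : {set G} | e \in edges G})%type :=
  fun x y => match x, y with
  | inl u, inr e | inr e, inl u => u \in val e
  | _, _ => false
  end.

Lemma subdiv_sym : symmetric subdiv_rel.
Proof. by case=> x []. Qed.

Lemma subdiv_irr : irreflexive subdiv_rel.
Proof. by case. Qed.

Definition subdivision : sgraph := SGraph subdiv_sym subdiv_irr.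
End Subdivision.

Definition subdivided_star (d : nat) : sgraph := subdivision (Kbip 1 d).

(* Main.v *)
(* Let [J] be an independent set of neighbours of [v]. Since [I] is maximum,
   every subset [W] of [J] has at least [#|W|] neighbours in [I]. An induced
   matching of size [d] between [J] and [I :\ v] would form, together with [v],
   an induced S_d, so it remains to find one when [J] is large.

   A minimal subset of [W] with the same neighbours as [W] spans an induced
   matching; hence few vertices of [J] have degree less than l^(d-1), and these
   are discarded. The matching is then chosen greedily: take [a] of least
   degree and l of its neighbours. By K_{l,l}-freeness fewer than l vertices are
   adjacent to all of them, so some neighbour [b] is missed by about a fraction
   1/l of the remaining vertices. Each of those has as many neighbours as [a],
   and misses [b], so it has a neighbour outside the neighbourhood of [a]; all
   but fewer than l of them have at least l^(d-2) such neighbours, since l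
   exceptions would have l common neighbours inside the neighbourhood of [a].
   Recurse on these vertices and on the complement of the neighbourhood of
   [a]. *)
Require Import Defs.
From mathcomp Require Import all_boot.
From mathcomp Require Import zify.

Set Implicit Arguments.
Unset Strict Implicit.
Unset Printing Implicit Defensive.

(** * Counting in finite sets *)

Lemma leq_card_bigcup (S T : finType) (D : {set S}) (F : S -> {set T}) (k : nat) :
  {in D, forall s, #|F s| <= k} -> #|\bigcup_(s in D) F s| <= #|D| * k.
Proof.
move=> hk; apply: (@leq_trans (\sum_(s in D) #|F s|)).
  apply: (big_ind2 (fun (U : {set T}) n => #|U| <= n)) => [|U m V n hU hV|//].
    by rewrite cards0.
  by apply: leq_trans (leq_add hU hV); rewrite cardsU leq_subr.
by rewrite -sum_nat_const; apply: leq_sum.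
Qed.

Lemma subset_of_card (T : finType) (A : {set T}) (k : nat) :
  k <= #|A| -> exists2 B : {set T}, B \subset A & #|B| = k.
Proof.
case/card_geqP => s [us ss sA]; exists [set x in s].
  by apply/subsetP => x; rewrite inE; exact: sA.
by rewrite cardsE (card_uniqP us).
Qed.

(** The elements of [F] that fail [P] for some [s] are covered by [#|D|] sets of size at most
    [k]. *)
Lemma card_forall_union_bound (S T : finType) (P : S -> T -> bool)
    (D : {set S}) (F : {set T}) (k : nat) :
  {in D, forall s, #|[set t in F | ~~ P s t]| <= k} ->
  #|F| <= #|[set t in F | [forall s in D, P s t]]| + #|D| * k.
Proof.
move=> hk; rewrite -(cardsID [set t | [forall s in D, P s t]] F) leq_add //.
  by apply: subset_leq_card; apply/subsetP => t; rewrite !inE.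
have -> : F :\: [set t | [forall s in D, P s t]]
    = \bigcup_(s in D) [set t in F | ~~ P s t].
  apply/setP => t; rewrite !inE; apply/idP/bigcupP.
    by case/andP=> /forall_inPn[s sD nP] tF; exists s; rewrite // inE tF.
  case=> s sD; rewrite inE => /andP[-> nP]; rewrite andbT.
  by apply/forall_inPn; exists s.
exact: leq_card_bigcup.
Qed.

(** * Induced matchings in bipartite relations *)

Section BipartiteRelation.
Variables (A B : finType) (r : A -> B -> bool).
Implicit Types (X W : {set A}) (Y : {set B}).

Definition nbh Y a : {set B} := [set b in Y | r a b].

Definition nbhs Y X : {set B} := [set b in Y | [exists a in X, r a b]].

Definition biclique_free l X Y : Prop :=
  forall (S : {set A}) (T : {set B}), S \subset X -> T \subset Y ->
    {in S & T, forall s t, r s t} -> l <= #|S| -> #|T| < l.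

(** The equation [r a (f c) = (a == c)] gives the matching edges, forbids all others and makes [f]
    injective on [C]. *)
Definition induced_matching n X Y : Prop :=
  exists (C : {set A}) (f : A -> B),
    [/\ C \subset X, #|C| = n, {in C, forall c, f c \in Y}
      & {in C &, forall a c, r a (f c) = (a == c)}].

Lemma biclique_freeS l X X' Y Y' :
  X' \subset X -> Y' \subset Y -> biclique_free l X Y -> biclique_free l X' Y'.
Proof.
by move=> sX sY h S T sS sT; apply: h; [apply: subset_trans sX|apply: subset_trans sY].
Qed.

Lemma induced_matchingS n X X' Y :
  X' \subset X -> induced_matching n X' Y -> induced_matching n X Y.
Proof.
by move=> sX [C [f [sC cC fY rC]]]; exists C, f; split=> //; apply: subset_trans sX.
Qed.

Lemma induced_matching1 X Y a : a \in X -> 0 < #|nbh Y a| -> induced_matching 1 X Y.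
Proof.
move=> aX /card_gt0P[b]; rewrite inE => /andP[bY rab].
exists [set a], (fun=> b); split=> [||//|x y /set1P-> /set1P->].
- by rewrite sub1set.
- by rewrite cards1.
- by rewrite rab eqxx.
Qed.

(** [X'] misses [b], and [a] misses the old right ends, so adding the edge from [a] to [b] creates
    no cross edge. *)
Lemma induced_matching_cons n X X' Y a b :
    a \in X -> X' \subset X -> b \in nbh Y a -> {in X', forall x, ~~ r x b} ->
  induced_matching n X' (Y :\: nbh Y a) -> induced_matching n.+1 X Y.
Proof.
rewrite inE => aX sX /andP[bY rab] nb [C [f [sC cC fY rC]]].
have aC : a \notin C by apply: contraTN rab => /(subsetP sC) /nb.
exists (a |: C), (fun c => if c == a then b else f c); split.
- by rewrite subUset sub1set aX (subset_trans sC).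
- by rewrite cardsU1 aC cC.
- move=> c /setU1P[->|cC']; first by rewrite eqxx.
  by case: eqP => // _; move: (fY _ cC'); rewrite inE => /andP[].
- move=> x y /setU1P[->|xC] /setU1P[->|yC]; rewrite ?eqxx //.
  + have ya : y != a by apply: contraNneq aC => <-.
    rewrite (negPf ya) eq_sym (negPf ya).
    by move: (fY _ yC); rewrite !inE => /andP[+ yY]; rewrite yY => /negPf.
  + have xa : x != a by apply: contraNneq aC => <-.
    by rewrite (negPf xa) (negPf (nb _ (subsetP sC _ xC))).
  + have ya : y != a by apply: contraNneq aC => <-.
    by rewrite (negPf ya) rC.
Qed.

(* In a set of vertices of [W] that is minimal for covering [nbhs Y W], every
   vertex has a private neighbour. *)
Lemma nbhs_bound d k W Y :
    {in W, forall a, #|nbh Y a| <= k} -> ~ induced_matching d.+1 W Y ->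
  #|nbhs Y W| <= d * k.
Proof.
move=> hk nM.
pose covers := [pred C : {set A} | (C \subset W) && (nbhs Y W \subset nbhs Y C)].
have [C /minsetP[/andP[sC cov] minC] _] : {C | minset covers C & C \subset W}.
  by apply: minset_exists; rewrite /= !subxx.
have private c : c \in C -> exists b, [&& b \in nbh Y c & [forall a in C, r a b ==> (a == c)]].
  move=> cC; apply/existsP; apply: contraT; rewrite negb_exists => /forallP nb.
  suff cov' : covers (C :\ c).
    by have := minC _ cov' (subsetDl _ _) => /setP/(_ c); rewrite !inE eqxx cC.
  rewrite /= (subset_trans (subsetDl _ _) sC); apply/subsetP => b bW.
  move/subsetP/(_ b bW): (cov); rewrite !inE => /andP[bY /exists_inP[a aC rab]].
  rewrite bY; apply/exists_inP.
  have [eac|nac] := eqVneq a c; last by exists a; rewrite // !inE nac.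
  move: (nb b); rewrite inE bY -eac rab /= => /forall_inPn[a' a'C].
  by rewrite negb_imply => /andP[ra' na']; exists a' => //; rewrite !inE na'.
have cardC : #|C| <= d.
  rewrite leqNgt; apply/negP => /subset_of_card[C' sC' cC']; apply: nM.
  pose P c b := [&& b \in nbh Y c & [forall a in C, r a b ==> (a == c)]].
  (* [b0] is a default value for [f]; [B] is inhabited because elements of [C'] have private
     neighbours. *)
  have [b0 _ | noB] := pickP (fun b : B => true); last first.
    have [c cC] : exists c, c \in C' by apply/card_gt0P; rewrite cC'.
    by have [b] := private _ (subsetP sC' _ cC); have := noB b.
  pose f c := odflt b0 [pick b | P c b].
  have fP c : c \in C' -> P c (f c).
    move=> /(subsetP sC') /private[b Pb].
    by rewrite /f; case: pickP => [//|/(_ b)]; rewrite /P Pb.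
  exists C', f; split=> //; first exact: subset_trans sC.
    by move=> c /fP /andP[]; rewrite inE => /andP[].
  move=> a c aC cC; have /andP[] := fP _ cC; rewrite inE => /andP[_ rc].
  move=> /forall_inP/(_ a (subsetP sC' _ aC))/implyP priv.
  by apply/idP/eqP => [/priv/eqP|->].
apply: leq_trans (subset_leq_card cov) _.
have -> : nbhs Y C = \bigcup_(a in C) nbh Y a.
  apply/setP => b; rewrite inE; apply/idP/bigcupP.
    by case/andP=> bY /exists_inP[a aC rab]; exists a; rewrite // inE bY.
  by case=> a aC; rewrite inE => /andP[-> rab]; apply/exists_inP; exists a.
apply: leq_trans (leq_card_bigcup (k := k) _) _.
  by move=> a /(subsetP sC) /hk.
by rewrite leq_mul2r cardC orbT.
Qed.

(** The bound [#|X| >= 2 * l ^ n - l] survives, with [n] lowered by one, passing to a fraction 1/l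
    and losing fewer than [l] vertices. At [n = 0] it says nothing once [l >= 2], hence
    [0 < #|X|]. *)
Lemma greedy_induced_matching l n X Y :
    0 < l -> biclique_free l X Y -> 0 < #|X| -> 2 * l ^ n <= #|X| + l ->
    {in X, forall a, l ^ n <= #|nbh Y a|} ->
  induced_matching n.+1 X Y.
Proof.
move=> l0; elim: n X Y => [|n IH] X Y free X0 cX deg.
  by case/card_gt0P: X0 => a aX; apply: (induced_matching1 aX); apply: deg.
case/card_gt0P: X0 => a0 a0X.
case: (arg_minnP (fun a => #|nbh Y a|) a0X) => a aX mina.
have ln0 : 0 < l ^ n by rewrite expn_gt0 l0.
have lnbh : l <= #|nbh Y a|.
  by apply: leq_trans (deg _ aX); rewrite expnS leq_pmulr.
have [L sL cL] := subset_of_card lnbh.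
(* Otherwise at least [#|X| - l * (2 * l ^ n - 2) >= l] vertices would be adjacent to all of [L]. *)
have [b bL cb] : exists2 b, b \in L & (2 * l ^ n).-1 <= #|[set x in X | ~~ r x b]|.
  apply/exists_inP; apply: contraT => /exists_inPn small.
  have := @card_forall_union_bound _ _ (fun b x => r x b) L X (2 * l ^ n - 2).
  set S := [set x in X | _]; rewrite cL => bnd.
  have {}bnd : #|X| <= #|S| + l * (2 * l ^ n - 2).
    by apply: bnd => b /small; lia.
  have cS : #|S| < l.
    rewrite ltnNge; apply/negP => lS.
    have := free S L; rewrite cL ltnn => F; apply: notF; apply: F => //.
    - by apply/subsetP => x; rewrite inE => /andP[].
    - by apply: subset_trans sL _; apply/subsetP => x; rewrite inE => /andP[].
    - by move=> s t; rewrite inE => /andP[_ /forall_inP]; apply.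
  by move: cX bnd cS ln0; rewrite expnS; nia.
set X1 := [set x in X | ~~ r x b] in cb.
have sX1 : X1 \subset X by apply/subsetP => x; rewrite inE => /andP[].
set Y1 := Y :\: nbh Y a.
have sY1 : Y1 \subset Y by apply: subsetDl.
pose W := [set x in X1 | #|nbh Y1 x| < l ^ n].
have nbhY1 x : nbh Y1 x = nbh Y x :\: nbh Y a.
  by apply/setP => y; rewrite !inE andbA.
have minX1 x : x \in X1 -> #|nbh Y a| <= #|nbh Y x|.
  by move=> /(subsetP sX1) /mina.
(* For [n = 0], a vertex of [W] has all its neighbours in [nbh Y a]; minimality forces equality, yet
   the vertex misses [b]. *)
have W0 : n = 0 -> W = set0.
  move=> n0; apply/setP => x; rewrite inE [in RHS]inE n0 ltnS leqn0 cards_eq0.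
  apply/negP => /andP[xX1]; rewrite nbhY1 setD_eq0 => sub.
  have := minX1 x xX1; move/(conj sub)/andP; rewrite -eqEcard => /eqP eqN.
  move: (subsetP sL b bL) xX1; rewrite -eqN !inE => /andP[_ ->].
  by rewrite andbF.
have cW : #|W| < l.
  rewrite ltnNge; apply/negP => /subset_of_card[S sS cS].
  have SX1 s : s \in S -> (s \in X1) && (#|nbh Y1 s| < l ^ n).
    by move/(subsetP sS); rewrite inE.
  pose T := [set t in nbh Y a | [forall s in S, r s t]].
  (* Each [s] has at least as many neighbours as [a], at most [l ^ n - 1] of them outside [nbh Y a],
     so it misses at most that many vertices of [nbh Y a]. This leaves
     [l ^ n.+1 - l * (l ^ n - 1) = l] vertices in [T]. *)
  have cT : #|nbh Y a| <= #|T| + l * (l ^ n).-1.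
    rewrite -[k in k * _]cS; apply: card_forall_union_bound => s /SX1/andP[/minX1 le_as].
    rewrite nbhY1 cardsD => lt_s; have := cardsD (nbh Y a) (nbh Y s).
    rewrite setIC => /esym.
    have -> : nbh Y a :\: nbh Y s = [set t in nbh Y a | ~~ r s t].
      by apply/setP => t; rewrite !inE; case: (t \in Y); rewrite //= andbC.
    have := subset_leq_card (subsetIl (nbh Y s) (nbh Y a)).
    have := subset_leq_card (subsetIr (nbh Y s) (nbh Y a)).
    lia.
  have lT : l <= #|T|.
    by move: (deg a aX) cT ln0; rewrite expnS; nia.
  have := free S T; rewrite cS leqnn ltnNge lT => F; apply: notF; apply: F => //.
  - by apply/subsetP => s /SX1/andP[/(subsetP sX1)].
  - by apply/subsetP => t; rewrite !inE => /andP[/andP[]].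
  - by move=> s t sS'; rewrite inE => /andP[_ /forall_inP]; apply.
have cD := cardsD X1 W.
rewrite (setIidPr _) in cD; last by apply/subsetP => x; rewrite inE => /andP[].
(* At most [l - 1] of at least [2 * l ^ n - 1] vertices are lost; for [n = 0] none can be spared,
   hence [W0]. *)
have cX1W : 0 < #|X1 :\: W| /\ 2 * l ^ n <= #|X1 :\: W| + l.
  case: (posnP n) => [n0|n_gt0].
    by move: cb cD; rewrite (W0 n0) n0 cards0 expn0; lia.
  have : l <= l ^ n by rewrite -[leqLHS]expn1 leq_pexp2l.
  lia.
have sXW : X1 :\: W \subset X1 by apply: subsetDl.
apply: (induced_matching_cons aX (subset_trans sXW sX1) (subsetP sL b bL)).
  by move=> x /(subsetP sXW); rewrite inE => /andP[].
apply: IH; try by case: cX1W.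
  exact: biclique_freeS (subset_trans sXW sX1) sY1 free.
by move=> x; rewrite 2!inE => /andP[+ xX1]; rewrite xX1 /= -leqNgt.
Qed.

(** Expansion and [nbhs_bound] allow at most [d * (l ^ d - 1) + 1] vertices of degree below [l ^ d];
    the greedy choice bounds the number of the others. *)
Lemma induced_matching_of_expansion l d X Y :
    0 < l -> 0 < d -> biclique_free l X Y ->
    (forall W, W \subset X -> #|W| <= #|nbhs Y W|.+1) ->
    ~ induced_matching d.+1 X Y ->
  #|X| + l <= d * (l ^ d).-1 + 2 * l ^ d.
Proof.
move=> l0 d0 free hall nM; pose W := [set a in X | #|nbh Y a| < l ^ d].
have sW : W \subset X by apply/subsetP => x; rewrite inE => /andP[].
have cW : #|W| <= (d * (l ^ d).-1).+1.
  apply: leq_trans (hall _ sW) _; rewrite ltnS; apply: nbhs_bound.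
    by move=> a; rewrite inE => /andP[_]; lia.
  by move=> M; apply: nM; apply: induced_matchingS M.
have cD := cardsD X W; rewrite (setIidPr sW) in cD.
rewrite leqNgt; apply/negP => big; apply: nM.
have cXW : 0 < #|X :\: W| /\ 2 * l ^ d <= #|X :\: W| + l.
  have : l <= l ^ d by rewrite -[leqLHS]expn1 leq_pexp2l.
  lia.
apply: (induced_matchingS (subsetDl X W)); apply: (greedy_induced_matching l0).
- exact: biclique_freeS (subsetDl X W) (subxx Y) free.
- by case: cXW.
- by case: cXW.
- by move=> x; rewrite 2!inE => /andP[+ xX]; rewrite xX /= -leqNgt.
Qed.
End BipartiteRelation.

(** * Forbidden induced subgraphs and maximum independent sets *)

Lemma independentP (G : sgraph) (S : {set G}) :
  reflect {in S &, forall x y, ~~ (x -- y)} (independent S).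
Proof.
apply: (iffP forall_inP) => [h x y xS yS|h x xS].
  by move/forall_inP: (h x xS); apply.
by apply/forall_inP => y yS; apply: h.
Qed.

Lemma leq_alpha (G : sgraph) (S : {set G}) : independent S -> #|S| <= alpha G.
Proof. by move=> iS; apply: (leq_bigmax_cond (F := fun S : {set G} => #|S|)). Qed.

Lemma free_no_embedding (F : sgraph -> Prop) (G H : sgraph) (f : H -> G) :
  free F G -> F H -> injective f -> {mono f : x y / x -- y} -> False.
Proof.
move=> fr FH injf monof; apply: (fr H FH).
exists [set x in codom f]; have fP h : f h \in [set x in codom f].
  by rewrite inE codom_f.
pose g h : induced [set x in codom f] := exist _ (f h) (fP h).
have injg : injective g by move=> h k [/injf].
have gP (x : induced [set x in codom f]) : exists h, g h == x.
  have := valP x; rewrite inE => /codomP[h xh].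
  by exists h; apply/eqP/val_inj.
pose g' x := xchoose (gP x).
have gK : cancel g' g by move=> x; apply/eqP/(xchooseP (gP x)).
have g'K : cancel g g' by move=> h; apply: injg; rewrite gK.
exists g'; first by exists g.
by move=> x y; rewrite -[x in RHS]gK -[y in RHS]gK /= /induced_rel /= monof.
Qed.

(** Both sides are independent, so a biclique is induced; irreflexivity keeps its sides disjoint. *)
Lemma biclique_free_adjacency (F : sgraph -> Prop) (G : sgraph) (l : nat)
    (J I : {set G}) :
  free F G -> F (Kbip l l) -> independent J -> independent I ->
  biclique_free (@sedge G) l J I.
Proof.
move=> fr FK /independentP iJ /independentP iI S T sS sT cST lS.
rewrite ltnNge; apply/negP => lT.
pose f (x : Kbip l l) : G := match x with
  | inl i => enum_val (widen_ord lS i) | inr i => enum_val (widen_ord lT i) end.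
have fS i : f (inl i) \in S by apply: enum_valP.
have fT i : f (inr i) \in T by apply: enum_valP.
have nST s t : s \in S -> t \in T -> s != t.
  by move=> sS' /(cST _ _ sS'); apply: contraTneq => ->; rewrite sedge_irr.
apply: (free_no_embedding (f := f) fr FK).
  case=> i [] j e; move/eqP: (e).
  - by move=> _; move: e => /enum_val_inj[/val_inj ->].
  - by rewrite (negPf (nST _ _ (fS i) (fT j))).
  - by rewrite eq_sym (negPf (nST _ _ (fS j) (fT i))).
  - by move=> _; move: e => /enum_val_inj[/val_inj ->].
case=> i [] j; rewrite [RHS]/=.
- by apply: negbTE; apply: iJ; apply: (subsetP sS).
- by apply: cST.
- by rewrite sedge_sym; apply: cST.
- by apply: negbTE; apply: iI; apply: (subsetP sT).
Qed.

Lemma edges_Kbip1P d (e : {set Kbip 1 d}) :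
  reflect (exists i, e = [set inl ord0; inr i]) (e \in edges (Kbip 1 d)).
Proof.
apply: (iffP imsetP) => [[[x y]]|[i ->]].
  rewrite inE /=; case: x y => i [] j //= _ ->.
    by exists j; rewrite [i]ord1.
  by exists i; rewrite [j]ord1 setUC.
by exists (inl ord0, inr i); rewrite ?inE.
Qed.

(** The centre is [v], the left ends in [J] subdivide the edges, and the right ends in [I] are the
    leaves. *)
Lemma subdivided_star_embedding (F : sgraph -> Prop) (G : sgraph) (d : nat)
    (v : G) (J I : {set G}) :
  free F G -> F (subdivided_star d) -> independent J -> independent I ->
  v \in I -> {in J, forall x, v -- x} ->
  ~ induced_matching (@sedge G) d J (I :\ v).
Proof.
move=> fr FS /independentP iJ /independentP iI vI vJ [C [m [sC cC mI mC]]].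
pose c (i : 'I_d) : G := enum_val (cast_ord (esym cC) i).
have cP i : c i \in C by apply: enum_valP.
have cJ i : c i \in J by apply: (subsetP sC).
have injc : injective c by move=> i j /enum_val_inj/cast_ord_inj.
have mP i : (m (c i) != v) && (m (c i) \in I) by have := mI _ (cP i); rewrite !inE.
have ec i j : c i -- m (c j) = (i == j) by rewrite mC // (inj_eq injc).
have JI x y : x \in J -> y \in I -> x != y.
  move=> xJ yI; apply: contraTneq (vJ x xJ) => ->.
  exact: iI.
(* Each edge of the star contains exactly one leaf, so [pick] finds its index and never falls back
   to the default [v]. *)
pose f (x : subdivided_star d) : G := match x with
  | inl (inl _) => v
  | inl (inr i) => m (c i)
  | inr e => if [pick i | inr i \in val e] is Some i then c i else v
  end.
have fe e : exists2 i, val e = [set inl ord0; inr i] & f (inr e) = c i.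
  case/edges_Kbip1P: (valP e) => i ei; exists i => //=.
  rewrite ei; case: pickP => [j|/(_ i)]; rewrite !inE ?eqxx //=.
  by case/eqP => ->.
apply: (free_no_embedding (f := f) fr FS).
  case=> [[i|i]|e] [[j|j]|e'] //.
  - by rewrite [i]ord1 [j]ord1.
  - by move=> /= e; have := mP j; rewrite -e eqxx.
  - have [k _ ->] := fe e'; move=> /= e.
    by have := JI _ _ (cJ k) vI; rewrite e eqxx.
  - by move=> /= e; have := mP i; rewrite e eqxx.
  - by move=> /= e; have := ec i j; rewrite -e ec eqxx => /esym/eqP ->.
  - have [k _ ->] := fe e'; move=> /= e; have /andP[_ mi] := mP i.
    by have := JI _ _ (cJ k) mi; rewrite e eqxx.
  - have [k _ ->] := fe e; move=> /= ee.
    by have := JI _ _ (cJ k) vI; rewrite ee eqxx.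
  - have [k _ ->] := fe e; move=> /= ee; have /andP[_ mi] := mP j.
    by have := JI _ _ (cJ k) mi; rewrite ee eqxx.
  - have [i ei ->] := fe e; have [j ej ->] := fe e' => /injc ij.
    by congr inr; apply: val_inj; rewrite /= ei ej ij.
have mII i : m (c i) \in I by case/andP: (mP i).
case=> [[i|i]|e] [[j|j]|e']; rewrite [RHS]/=.
- exact: sedge_irr.
- by apply: negbTE; apply: iI => /=.
- by have [k ek ->] := fe e'; rewrite ek [i]ord1 !inE eqxx; apply: vJ.
- by apply: negbTE; apply: iI => /=.
- by apply: negbTE; apply: iI => /=.
- by have [k ek ->] := fe e'; rewrite ek sedge_sym ec !inE /= eq_sym.
- by have [k ek ->] := fe e; rewrite ek [j]ord1 !inE eqxx sedge_sym; apply: vJ.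
- by have [k ek ->] := fe e; rewrite ek ec !inE /= eq_sym.
- by have [k ek ->] := fe e; have [k' ek' ->] := fe e'; apply: negbTE; apply: iJ.
Qed.

(* Otherwise exchanging [W] for its neighbours in [I] would enlarge [I]. *)
Lemma leq_card_nbhs_maximum_independent (G : sgraph) (I W : {set G}) :
  maximum_independent I -> independent W -> [disjoint W & I] ->
  #|W| <= #|nbhs (@sedge G) I W|.
Proof.
case/andP=> /independentP iI /eqP cI /independentP iW dWI.
set N := nbhs _ I W.
have adj x y : x \in W -> y \in I :\: N -> ~~ (x -- y).
  move=> xW; rewrite !inE => /andP[+ yI]; rewrite yI /=.
  by move/exists_inPn; apply.
have : independent (W :|: (I :\: N)).
  apply/independentP => x y /setUP[xW|xI] /setUP[yW|yI].
  - exact: iW.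
  - exact: adj.
  - by rewrite sedge_sym; apply: adj.
  - by apply: iI; [case/setDP: xI|case/setDP: yI].
move/leq_alpha; rewrite -cI cardsU (_ : W :&: _ = set0); last first.
  apply/eqP; rewrite setI_eq0; apply: disjointWr dWI; exact: subsetDl.
have sN : N \subset I by apply/subsetP => x; rewrite inE => /andP[].
have := subset_leq_card sN.
by rewrite cards0 cardsD (setIidPr sN); lia.
Qed.

Lemma alpha_induced_ltn (G : sgraph) (A : {set G}) (k : nat) :
  0 < k -> (forall S : {set G}, S \subset A -> independent S -> #|S| < k) ->
  alpha (induced A) < k.
Proof.
case: k => // k _ h; rewrite ltnS; apply/bigmax_leqP => S /independentP iS.
rewrite -(card_imset _ val_inj) -ltnS; apply: h.
  by apply/subsetP => _ /imsetP[x _ ->]; apply: valP.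
apply/independentP => _ _ /imsetP[x xS ->] /imsetP[y yS ->].
exact: (iS x y).
Qed.

(** * Independent sets in a closed neighbourhood *)

Theorem theorem3p4 (d l : nat) (hd : 2 <= d) (hl : 2 <= l) (G : sgraph)
    (hG : free (fun H => H = subdivided_star d \/ H = Kbip l l) G)
    (I : {set G}) (hI : maximum_independent I) :
  (forall v : G, v \in I ->
     alpha (induced N[v]) < d ^ 2 * l + 2 * d * l ^ (d - 1)) /\
  (d = 2 -> forall v : G, v \in I -> alpha (induced N[v]) < 2 * l).
Proof.
have iI : independent I by case/andP: hI.
(* If [J] contains [v], it has no other element; otherwise all of [J] is adjacent to [v]. *)
have bound v (J : {set G}) : v \in I -> J \subset N[v] -> independent J ->
    #|J| <= 1 \/ #|J| + l <= (d - 1) * (l ^ (d - 1)).-1 + 2 * l ^ (d - 1).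
  move=> vI sJ iJ; have /independentP ijJ := iJ; have [vJ|vJ] := boolP (v \in J).
    left; rewrite -(cards1 v) subset_leq_card //; apply/subsetP => x xJ.
    move/subsetP/(_ x xJ): sJ; rewrite !inE => /orP[//|].
    by rewrite (negPf (ijJ _ _ vJ xJ)).
  right; have adj : {in J, forall x, v -- x}.
    move=> x xJ; move/subsetP/(_ x xJ): sJ; rewrite inE => /orP[/eqP xv|//].
    by rewrite -xv xJ in vJ.
  have sI := subsetDl I [set v].
  apply: (@induced_matching_of_expansion _ _ (@sedge G) l (d - 1) J (I :\ v)).
  - lia.
  - lia.
  - apply: biclique_freeS (subxx J) sI _.
    by apply: (biclique_free_adjacency hG); [right| |].
  - move=> W sW.
    have iW : independent W.
      by apply/independentP => x y /(subsetP sW) xJ /(subsetP sW); apply: ijJ.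
    have dWI : [disjoint W & I].
      rewrite disjoint_subset; apply/subsetP => x /(subsetP sW) xJ.
      rewrite inE; apply: contraL (adj x xJ) => xI.
      by move/independentP: iI; apply.
    apply: leq_trans (leq_card_nbhs_maximum_independent hI iW dWI) _.
    (* Deleting [v] from [I] costs at most one neighbour. *)
    apply: (@leq_trans #|v |: nbhs (@sedge G) (I :\ v) W|); last first.
      by rewrite cardsU1; case: (_ \in _); rewrite ?add1n ?add0n.
    apply: subset_leq_card; apply/subsetP => y; rewrite !inE => /andP[yI ->].
    by rewrite yI; case: (y == v).
  - rewrite subn1 prednK; last by lia.
    by apply: (subdivided_star_embedding hG); [left| | | |].
have l_gt0 : 0 < l ^ (d - 1) by rewrite expn_gt0; lia.
split=> [v vI|d2 v vI]; apply: alpha_induced_ltn => [|S sS iS].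
- nia.
(* In the main case [#|S| <= (d + 1) * l ^ (d - 1)], and [d + 1 < 2 * d]. *)
- by case: (bound v S vI sS iS); nia.
- lia.
(* Here the main case reads [#|S| + l <= (l - 1) + 2 * l]. *)
- by have := bound v S vI sS iS; rewrite d2 expn1; lia.
Qed.
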